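(* Let $m\neq 0$, $a_1$, $a_2$ be real numbers and put $\bar A=a_1+a_2+m$. For every integer $n\ge 0$ and every real $x$, the noncentral Tanny-Dowling polynomials satisfy $$x\sum_{k=0}^n\binom{n}{k}\widetilde{\mathcal F}_{m,a_1}(k;x)\,\widetilde{\mathcal F}_{m,a_2}(n-k;x)=\widetilde{\mathcal F}_{m,\bar A}(n+1;x)+\bar A\,\widetilde{\mathcal F}_{m,\bar A}(n;x).$$
   Context: For real $m\ne0$ and real $a$, the noncentral Whitney numbers of the second kind $\widetilde W_{m,a}(n,k)$ ($0\le k\le n$) are given by $\sum_{n\ge k}\widetilde W_{m,a}(n,k)\frac{z^n}{n!}=\frac{e^{-az}}{k!}\left(\frac{e^{mz}-1}{m}\right)^k$. The noncentral Tanny-Dowling polynomials are $\widetilde{\mathcal F}_{m,a}(n;x)=\sum_{k=0}^n k!\,\widetilde W_{m,a}(n,k)x^k$; equivalently, as formal power series in $z$, $\sum_{n\ge0}\widetilde{\mathcal F}_{m,a}(n;x)\frac{z^n}{n!}=\frac{me^{-az}}{m-x(e^{mz}-1)}$. Convention: $0^0=1$. *)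

(* Defs.v *)
From Stdlib Require Import Reals Factorial Lra Lia.
From Coquelicot Require Import Coquelicot.
Open Scope R_scope.

(** A formal power series over [R] is its coefficient sequence [nat -> R];
    its product is Coquelicot's Cauchy product [PS_mult]. *)

Definition PS_one (n : nat) : R := match n with O => 1 | S _ => 0 end.

Fixpoint PS_pow (a : nat -> R) (k : nat) : nat -> R :=
  match k with
  | O => PS_one
  | S k' => PS_mult a (PS_pow a k')
  end.

(** [exp (c z)].  Since [0 ^ 0 = 1] for [pow], this is [PS_one] when [c = 0]. *)
Definition PS_exp (c : R) (n : nat) : R := c ^ n / INR (fact n).

(** [exp (- a z) / k! * ((exp (m z) - 1) / m) ^ k] *)
Definition whitney_egf (m a : R) (k : nat) : nat -> R :=
  PS_mult (PS_scal (/ INR (fact k)) (PS_exp (- a)))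
          (PS_pow (PS_scal (/ m) (PS_minus (PS_exp m) PS_one)) k).

(** The sequence with exponential generating function [whitney_egf m a k];
    it vanishes for [n < k] (see [noncentral_whitney_small]). *)
Definition noncentral_whitney (m a : R) (n k : nat) : R :=
  INR (fact n) * whitney_egf m a k n.

Definition tanny_dowling (m a : R) (n : nat) (x : R) : R :=
  sum_f_R0 (fun k => INR (fact k) * noncentral_whitney m a n k * x ^ k) n.

Lemma PS_pow_small (a : nat -> R) (k : nat) :
  a O = 0 -> forall n, (n < k)%nat -> PS_pow a k n = 0.
Proof.
intros a0; induction k as [|k IH]; intros n Hn; [lia|].
simpl; unfold PS_mult.
rewrite <- (Rmult_0_l (INR (S n))), <- sum_cte.
apply sum_eq; intros i Hi.
destruct i as [|i]; [rewrite a0; ring|].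
rewrite IH by lia; ring.
Qed.

Lemma noncentral_whitney_small (m a : R) (n k : nat) :
  (n < k)%nat -> noncentral_whitney m a n k = 0.
Proof.
intros Hn; unfold noncentral_whitney, whitney_egf, PS_mult.
apply Rmult_eq_0_compat_l.
rewrite <- (Rmult_0_l (INR (S n))), <- sum_cte.
apply sum_eq; intros i Hi.
rewrite PS_pow_small; [ring| |lia].
change (/ m * (m ^ 0 / INR (fact 0) + - 1) = 0).
simpl; unfold Rdiv; rewrite Rinv_1; ring.
Qed.

(** The formal generating function is the analytic one: all the series
    involved converge everywhere. *)

Lemma CV_radius_entire (a : nat -> R) :
  (forall x, ex_pseries a x) -> CV_radius a = p_infty.
Proof.
intros H.
assert (Hx : forall x, ~ Rbar_lt (CV_radius a) (Rabs x)).
{ intros x Hx; apply (CV_disk_outside a x Hx).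
  apply ex_series_lim_0.
  destruct (H x) as [l Hl]; exists l.
  apply is_pseries_R; exact Hl. }
pose proof (CV_radius_ge_0 a) as H0.
destruct (CV_radius a) as [r| |]; [|reflexivity|destruct H0].
simpl in H0; exfalso; apply (Hx (r + 1)); simpl.
rewrite Rabs_pos_eq; lra.
Qed.

Lemma is_pseries_mult_entire (a b : nat -> R) (f g : R -> R) :
  (forall x, is_pseries a x (f x)) -> (forall x, is_pseries b x (g x)) ->
  forall x, is_pseries (PS_mult a b) x (f x * g x).
Proof.
intros Ha Hb x.
assert (Ra : CV_radius a = p_infty).
{ apply CV_radius_entire; intros y; exists (f y); apply Ha. }
assert (Rb : CV_radius b = p_infty).
{ apply CV_radius_entire; intros y; exists (g y); apply Hb. }
apply is_pseries_mult; [apply Ha|apply Hb|rewrite Ra|rewrite Rb]; exact I.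
Qed.

Lemma is_pseries_one (x : R) : is_pseries PS_one x 1.
Proof.
apply is_pseries_R, is_series_Reals.
intros eps Heps; exists O; intros n _.
replace (sum_f_R0 (fun n => PS_one n * x ^ n) n) with 1.
- now rewrite R_dist_eq.
- induction n as [|n IH]; simpl; [ring|rewrite <- IH; ring].
Qed.

Lemma is_pseries_pow (a : nat -> R) (f : R -> R) (k : nat) :
  (forall x, is_pseries a x (f x)) ->
  forall x, is_pseries (PS_pow a k) x (f x ^ k).
Proof.
intros Ha; induction k as [|k IH]; intros x; simpl.
- apply is_pseries_one.
- apply (is_pseries_mult_entire a _ f (fun x => f x ^ k)); auto.
Qed.

Lemma is_pseries_exp (c x : R) : is_pseries (PS_exp c) x (exp (c * x)).
Proof.
apply is_pseries_R.
assert (E : forall n, / INR (fact n) * (c * x) ^ n = PS_exp c n * x ^ n).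
{ intros n; unfold PS_exp; rewrite Rpow_mult_distr; unfold Rdiv; ring. }
apply (is_series_ext _ _ _ E), is_pseries_R, is_exp_Reals.
Qed.

Lemma noncentral_whitney_egf (m a z : R) (k : nat) :
  is_pseries (fun n => noncentral_whitney m a n k / INR (fact n)) z
    (exp (- a * z) / INR (fact k) * ((exp (m * z) - 1) / m) ^ k).
Proof.
assert (E : forall n,
  whitney_egf m a k n = noncentral_whitney m a n k / INR (fact n)).
{ intros n; unfold noncentral_whitney; field; apply INR_fact_neq_0. }
apply (is_pseries_ext _ _ _ _ E).
apply (is_pseries_mult_entire _ _
  (fun z => exp (- a * z) / INR (fact k))
  (fun z => ((exp (m * z) - 1) / m) ^ k)).
- intros x; unfold Rdiv; rewrite Rmult_comm.
  apply (is_pseries_scal (/ INR (fact k)) (PS_exp (- a)) x (exp (- a * x))).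
  + apply Rmult_comm.
  + apply is_pseries_exp.
- apply (is_pseries_pow _ (fun z => (exp (m * z) - 1) / m)).
  intros x; unfold Rdiv; rewrite Rmult_comm.
  apply (is_pseries_scal (/ m) (PS_minus (PS_exp m) PS_one) x
           (exp (m * x) - 1)).
  + apply Rmult_comm.
  + apply (is_pseries_minus (PS_exp m) PS_one x (exp (m * x)) 1).
    * apply is_pseries_exp.
    * apply is_pseries_one.
Qed.

(* Main.v *)
Require Import Defs.
From Stdlib Require Import Reals Factorial Lia FunctionalExtensionality.
From Coquelicot Require Import Coquelicot.
Open Scope R_scope.

(** The identity is the coefficient form of a differential equation between
    formal power series in [z].

    Put [v = x (exp (m z) - 1) / m] and [G = 1 / (1 - v)].  Since [v] has no
    constant term, [G] is the sum of the powers of [v], a locally finite sum,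
    and the exponential generating function of the polynomials with parameter
    [a] is [exp (- a z) G] ([tanny_dowling_egfE]).  Write [D] for [d/dz].  From
    [D v = x exp (m z)] and [D G = D v * G^2] ([PS_derive_geom]), Leibniz' rule
    gives, for [A = a1 + a2 + m],
      [(D + A) (exp (- A z) G) = exp (- A z) * D G
                               = x (exp (- a1 z) G) (exp (- a2 z) G)],
    because the summand [m] of [A] absorbs the factor [exp (m z)] of [D v].
    On exponential generating functions [D] is the shift of the sequence and
    the product is the binomial convolution, so comparing coefficients of
    [z^n / n!] yields the theorem.

    Everything is formal: coefficient sequences are made into a commutative
    ring for [ring], on which [PS_derive] is a derivation. *)

(** * The ring of formal power series *)

Declare Scope fps_scope.
Delimit Scope fps_scope with fps.
(** Instances of the operations of a general normed module, with [nat -> R] as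
    the only carrier: this is the type under which [ring] looks them up. *)
Definition PS_add : (nat -> R) -> (nat -> R) -> nat -> R :=
  @PS_plus R_AbsRing R_NormedModule.
Definition PS_sub : (nat -> R) -> (nat -> R) -> nat -> R :=
  @PS_minus R_AbsRing R_NormedModule.
Definition PS_neg : (nat -> R) -> nat -> R :=
  @PS_opp R_AbsRing R_NormedModule.

Notation "a + b" := (PS_add a b) : fps_scope.
Notation "a - b" := (PS_sub a b) : fps_scope.
Notation "a * b" := (PS_mult a b) : fps_scope.

Definition PS_const (c : R) (n : nat) : R := match n with O => c | S _ => 0 end.

Definition PS_shift (a : nat -> R) (n : nat) : R := a (S n).

Lemma PS_add_coef (a b : nat -> R) n : (a + b)%fps n = a n + b n.
Proof. reflexivity. Qed.

(** This and its mirror image [PS_mult_Sr] turn identities between Cauchy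
    products into inductions on the coefficient, with no exchange of double
    sums. *)
Lemma PS_mult_Sl (a b : nat -> R) n :
  (a * b)%fps (S n) = a O * b (S n) + (PS_shift a * b)%fps n.
Proof. unfold PS_mult; rewrite decomp_sum by lia; reflexivity. Qed.

Lemma PS_mult_Sr (a b : nat -> R) n :
  (a * b)%fps (S n) = (a * PS_shift b)%fps n + a (S n) * b O.
Proof.
unfold PS_mult; rewrite tech5, Nat.sub_diag; f_equal.
apply sum_eq; intros i Hi; unfold PS_shift.
now replace (S n - i)%nat with (S (n - i)) by lia.
Qed.

Lemma PS_mult_comm (a b : nat -> R) : (a * b = b * a)%fps.
Proof.
apply functional_extensionality; intros n; revert a b.
induction n as [|n IH]; intros a b; [unfold PS_mult; simpl; ring|].
rewrite PS_mult_Sl, PS_mult_Sr, IH; ring.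
Qed.

Lemma PS_mult_add_distr_l (a b c : nat -> R) :
  ((a + b) * c = a * c + b * c)%fps.
Proof.
apply functional_extensionality; intros n; rewrite PS_add_coef.
unfold PS_mult; rewrite <- sum_plus; apply sum_eq; intros i _.
rewrite PS_add_coef; ring.
Qed.

Lemma PS_mult_const (c : R) (a : nat -> R) n :
  (PS_const c * a)%fps n = c * a n.
Proof.
destruct n as [|n]; [reflexivity|].
rewrite PS_mult_Sl; unfold PS_mult.
replace (sum_f_R0 _ n) with 0; [simpl; ring|].
rewrite <- (Rmult_0_l (INR (S n))), <- sum_cte.
apply sum_eq; intros i _; unfold PS_shift; simpl; ring.
Qed.

Lemma PS_scal_const (c : R) (a : nat -> R) :
  @PS_scal R_AbsRing R_NormedModule c a = (PS_const c * a)%fps.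
Proof.
apply functional_extensionality; intros n; now rewrite PS_mult_const.
Qed.

Lemma PS_one_const : PS_one = PS_const 1.
Proof. reflexivity. Qed.

Lemma PS_const_mult (c d : R) : PS_const (c * d) = (PS_const c * PS_const d)%fps.
Proof.
apply functional_extensionality; intros n; rewrite PS_mult_const.
destruct n; simpl; ring.
Qed.

Lemma PS_mult_const_mult (c : R) (a b : nat -> R) n :
  (PS_const c * a * b)%fps n = c * (a * b)%fps n.
Proof.
unfold PS_mult at 1; unfold PS_mult at 2; rewrite scal_sum.
apply sum_eq; intros i _; rewrite PS_mult_const; ring.
Qed.

Lemma PS_mult_assoc (a b c : nat -> R) : (a * (b * c) = a * b * c)%fps.
Proof.
apply functional_extensionality; intros n; revert a b c.
induction n as [|n IH]; intros a b c; [unfold PS_mult; simpl; ring|].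
assert (E : PS_shift (a * b)%fps
            = (PS_const (a O) * PS_shift b + PS_shift a * b)%fps).
{ apply functional_extensionality; intros k; unfold PS_shift at 1.
  rewrite PS_mult_Sl, PS_add_coef, PS_mult_const; reflexivity. }
rewrite PS_mult_Sl, (PS_mult_Sl (a * b)%fps), E, PS_mult_add_distr_l.
rewrite PS_add_coef, PS_mult_const_mult, PS_mult_Sl, IH.
change ((a * b)%fps O) with (a O * b O); ring.
Qed.

Lemma PS_ring_theory :
  ring_theory (PS_const 0) PS_one PS_add PS_mult PS_sub PS_neg eq.
Proof.
constructor; intros; try (apply functional_extensionality; intros n).
- destruct n; apply Rplus_0_l.
- apply Rplus_comm.
- symmetry; apply Rplus_assoc.
- rewrite PS_one_const, PS_mult_const; ring.
- now rewrite PS_mult_comm.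
- now rewrite PS_mult_assoc.
- now rewrite PS_mult_add_distr_l.
- reflexivity.
- destruct n; apply Rplus_opp_r.
Qed.

Add Ring PS_ring : PS_ring_theory.

(** * The formal derivative *)

(** The coefficient of index [n + 1] of [a * b] sums over pairs [i + j = n + 1];
    its weight [n + 1] splits as [i + j].  The term [i = 0] drops out of the
    first half and the term [j = 0] out of the second, and what is left are the
    two products. *)
Lemma PS_derive_mult (a b : nat -> R) :
  PS_derive (a * b)%fps = (PS_derive a * b + a * PS_derive b)%fps.
Proof.
apply functional_extensionality; intros n.
rewrite PS_add_coef; unfold PS_derive at 1.
transitivity (sum_f_R0 (fun i => INR i * a i * b (S n - i)%nat) (S n)
  + sum_f_R0 (fun i => a i * (INR (S n - i) * b (S n - i)%nat)) (S n)).
- unfold PS_mult; rewrite scal_sum, <- sum_plus.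
  apply sum_eq; intros i Hi; rewrite minus_INR by lia; ring.
- f_equal.
  + rewrite decomp_sum by lia; simpl (INR 0).
    rewrite !Rmult_0_l, Rplus_0_l; reflexivity.
  + rewrite tech5, Nat.sub_diag; simpl (INR 0).
    rewrite Rmult_0_l, Rmult_0_r, Rplus_0_r.
    apply sum_eq; intros i Hi; unfold PS_derive.
    now replace (S n - i)%nat with (S (n - i)) by lia.
Qed.

Lemma PS_derive_add (a b : nat -> R) :
  PS_derive (a + b)%fps = (PS_derive a + PS_derive b)%fps.
Proof.
apply functional_extensionality; intros n; apply Rmult_plus_distr_l.
Qed.

Lemma PS_derive_const (c : R) : PS_derive (PS_const c) = PS_const 0.
Proof.
apply functional_extensionality; intros n; unfold PS_derive, PS_const.
destruct n; ring.
Qed.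

Lemma PS_derive_exp (c : R) : PS_derive (PS_exp c) = (PS_const c * PS_exp c)%fps.
Proof.
apply functional_extensionality; intros n; rewrite PS_mult_const.
unfold PS_derive, PS_exp; rewrite fact_simpl, mult_INR; simpl pow.
field; split; [apply INR_fact_neq_0|apply not_0_INR; lia].
Qed.

Lemma PS_exp_plus (c d : R) : PS_exp (c + d) = (PS_exp c * PS_exp d)%fps.
Proof.
apply functional_extensionality; intros n; unfold PS_exp at 1, PS_mult.
rewrite binomial; unfold Rdiv; rewrite Rmult_comm, scal_sum.
apply sum_eq; intros i _; unfold Binomial.C, PS_exp.
field; repeat split; apply INR_fact_neq_0.
Qed.

(** * The geometric series *)

(** [1 / (1 - v)] for [v] without constant term; powers [v ^ k] with [k > n] do
    not reach the coefficient of index [n]. *)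
Definition PS_geom (v : nat -> R) (n : nat) : R :=
  sum_f_R0 (fun k => PS_pow v k n) n.

Lemma PS_geom_trunc (v : nat -> R) (n N : nat) :
  v O = 0 -> (n <= N)%nat -> sum_f_R0 (fun k => PS_pow v k n) N = PS_geom v n.
Proof.
intros v0; induction 1 as [|N HN IH]; [reflexivity|].
rewrite tech5, IH, PS_pow_small by (assumption || lia); ring.
Qed.

Lemma PS_mult_sum (a : nat -> R) (f : nat -> nat -> R) (N n : nat) :
  (a * (fun j => sum_f_R0 (fun k => f k j) N))%fps n
  = sum_f_R0 (fun k => (a * f k)%fps n) N.
Proof.
induction N as [|N IH]; [reflexivity|].
rewrite tech5, <- IH, <- PS_add_coef.
apply (f_equal (fun b => b n)).
transitivity (a * ((fun j => sum_f_R0 (fun k => f k j) N) + f (S N)))%fps;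
  [reflexivity|ring].
Qed.

Lemma PS_mult_geom (a v : nat -> R) (n : nat) :
  v O = 0 -> (a * PS_geom v)%fps n = sum_f_R0 (fun k => (a * PS_pow v k)%fps n) n.
Proof.
intros v0; rewrite <- PS_mult_sum; apply sum_eq; intros i Hi.
now rewrite (PS_geom_trunc v _ n) by (assumption || lia).
Qed.

Lemma PS_geom_inv (v : nat -> R) :
  v O = 0 -> PS_geom v = (PS_one + v * PS_geom v)%fps.
Proof.
intros v0; apply functional_extensionality; intros n.
rewrite PS_add_coef, PS_mult_geom by assumption.
rewrite <- (PS_geom_trunc v n (S n)), decomp_sum by (assumption || lia).
reflexivity.
Qed.

(** Differentiating [(1 - v) G = 1] gives [(1 - v) G' = v' G]; multiplying by
    [G] clears [1 - v]. *)
Lemma PS_derive_geom (v : nat -> R) :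
  v O = 0 ->
  PS_derive (PS_geom v) = (PS_derive v * PS_geom v * PS_geom v)%fps.
Proof.
intros v0; pose proof (PS_geom_inv v v0) as HG.
pose proof (f_equal PS_derive HG) as HD.
rewrite PS_derive_add, PS_one_const, PS_derive_const, PS_derive_mult in HD.
set (G := PS_geom v) in *; set (G' := PS_derive G) in *.
set (v' := PS_derive v) in *.
assert (H1 : (G - v * G = PS_one)%fps).
{ transitivity (PS_one + v * G - v * G)%fps; [now rewrite <- HG|ring]. }
assert (H2 : (G' - v * G' = v' * G)%fps).
{ transitivity (PS_const 0 + (v' * G + v * G') - v * G')%fps;
    [now rewrite <- HD|ring]. }
transitivity (G' * (G - v * G))%fps; [rewrite H1; ring|].
transitivity ((G' - v * G') * G)%fps; [ring|now rewrite H2].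
Qed.

(** * The generating function of the Tanny-Dowling polynomials *)

(** [x (exp (m z) - 1) / m] *)
Definition dowling_ratio (m x : R) : nat -> R :=
  (PS_const x * (PS_const (/ m) * (PS_exp m - PS_one)))%fps.

Lemma dowling_ratio_0 (m x : R) : dowling_ratio m x O = 0.
Proof.
unfold dowling_ratio; rewrite !PS_mult_const.
change (x * (/ m * (m ^ 0 / INR (fact 0) + - 1)) = 0); simpl; unfold Rdiv; rewrite Rinv_1; ring.
Qed.

Lemma PS_derive_dowling_ratio (m x : R) :
  m <> 0 -> PS_derive (dowling_ratio m x) = (PS_const x * PS_exp m)%fps.
Proof.
intros hm; unfold dowling_ratio.
replace (PS_exp m - PS_one)%fps with (PS_exp m + PS_const (-1))%fps.
- rewrite !PS_derive_mult, PS_derive_add, !PS_derive_const, PS_derive_exp.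
  assert (H : (PS_const (/ m) * PS_const m = PS_one)%fps)
    by (rewrite <- PS_const_mult, Rinv_l by assumption; reflexivity).
  transitivity (PS_const x * (PS_const (/ m) * PS_const m) * PS_exp m)%fps;
    [ring|rewrite H; ring].
- apply functional_extensionality; intros [|n]; [reflexivity|].
  change (PS_exp m (S n) + 0 = PS_exp m (S n) + - 0); ring.
Qed.

Lemma PS_pow_const (c : R) (a : nat -> R) (k : nat) :
  PS_pow (PS_const c * a)%fps k = (PS_const (c ^ k) * PS_pow a k)%fps.
Proof.
induction k as [|k IH]; simpl.
- rewrite <- PS_one_const; ring.
- rewrite IH, PS_const_mult; ring.
Qed.

Definition tanny_dowling_egf (m a x : R) : nat -> R :=
  (PS_exp (- a) * PS_geom (dowling_ratio m x))%fps.

(** The factor [k!] of the polynomial cancels the [/ k!] of the Whitney series,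
    so that summing over [k] produces the plain geometric series in [v]. *)
Lemma tanny_dowling_egfE (m a x : R) (n : nat) :
  tanny_dowling m a n x = INR (fact n) * tanny_dowling_egf m a x n.
Proof.
unfold tanny_dowling_egf; rewrite PS_mult_geom by apply dowling_ratio_0.
unfold tanny_dowling; rewrite scal_sum; apply sum_eq; intros k _.
unfold noncentral_whitney, whitney_egf, dowling_ratio, PS_sub.
rewrite !PS_scal_const, (PS_pow_const x), PS_mult_const_mult.
set (U := PS_pow _ k).
replace (PS_exp (- a) * (PS_const (x ^ k) * U))%fps
  with (PS_const (x ^ k) * PS_exp (- a) * U)%fps by ring.
rewrite PS_mult_const_mult; field; apply INR_fact_neq_0.
Qed.

(** The operator [D + A] annihilates [exp (- A z)], hence hits only the geometric
    factor [G]; the square in [D G] supplies one copy of [G] for each of the two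
    generating functions on the right. *)
Lemma tanny_dowling_egf_ode (m a1 a2 x : R) :
  m <> 0 ->
  (PS_derive (tanny_dowling_egf m (a1 + a2 + m) x)
   + PS_const (a1 + a2 + m) * tanny_dowling_egf m (a1 + a2 + m) x
   = PS_const x * (tanny_dowling_egf m a1 x * tanny_dowling_egf m a2 x))%fps.
Proof.
intros hm; unfold tanny_dowling_egf; set (A := a1 + a2 + m).
rewrite PS_derive_mult, PS_derive_exp, PS_derive_geom
  by apply dowling_ratio_0.
rewrite PS_derive_dowling_ratio by assumption.
set (G := PS_geom _).
assert (HA : (PS_const (- A) + PS_const A = PS_const 0)%fps).
{ apply functional_extensionality; intros [|k]; rewrite PS_add_coef;
    simpl; ring. }
assert (HE : (PS_exp (- A) * PS_exp m = PS_exp (- a1) * PS_exp (- a2))%fps).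
{ rewrite <- !PS_exp_plus; f_equal; unfold A; ring. }
transitivity ((PS_const (- A) + PS_const A) * (PS_exp (- A) * G)
  + PS_const x * (PS_exp (- A) * PS_exp m) * (G * G))%fps; [ring|].
rewrite HA, HE; ring.
Qed.

Theorem theorem3 (m a1 a2 : R) (hm : m <> 0) (n : nat) (x : R) :
  x * sum_f_R0
        (fun k => Binomial.C n k * tanny_dowling m a1 k x
                  * tanny_dowling m a2 (n - k) x) n
  = tanny_dowling m (a1 + a2 + m) (S n) x
    + (a1 + a2 + m) * tanny_dowling m (a1 + a2 + m) n x.
Proof.
pose proof (f_equal (fun a => a n) (tanny_dowling_egf_ode m a1 a2 x hm)) as H.
cbv beta in H; rewrite PS_add_coef, !PS_mult_const in H.
unfold PS_derive in H.
rewrite !tanny_dowling_egfE, fact_simpl, mult_INR.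
transitivity (INR (fact n) * (x *
  (tanny_dowling_egf m a1 x * tanny_dowling_egf m a2 x)%fps n)).
- replace (sum_f_R0 _ n) with (INR (fact n) *
    (tanny_dowling_egf m a1 x * tanny_dowling_egf m a2 x)%fps n); [ring|].
  unfold PS_mult; rewrite scal_sum; apply sum_eq; intros k _.
  rewrite !tanny_dowling_egfE; unfold Binomial.C.
  field; split; apply INR_fact_neq_0.
- rewrite <- H; ring.
Qed.
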